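(* Let $A$ be a nonempty set, $X$ a nonempty set, $F:A\to\mathcal P(X)$ a soft set with nonempty sections, and $\tau_1,\tau_2$ soft topologies on $F$. Let $j\in\{0,1,2\}$, where pairwise $T_2$ means pairwise Hausdorff (pairwise selector-Hausdorff in the soft case). For $t\in A$ write $\mathcal F_t:=(F(t),(\tau_1)_t,(\tau_2)_t)$. (i) If $(F,\tau_1,\tau_2)$ is pairwise soft $T_j$, then every $\mathcal F_t$ ($t\in A$) is pairwise $T_j$. (ii) If both $\tau_1$ and $\tau_2$ are canonical and every $\mathcal F_t$ is pairwise $T_j$, then $(F,\tau_1,\tau_2)$ is pairwise soft $T_j$. Hence, if $\tau_1$ and $\tau_2$ are canonical, $(F,\tau_1,\tau_2)$ is pairwise soft $T_j$ if and only if $(F(t),(\tau_1)_t,(\tau_2)_t)$ is pairwise $T_j$ for every $t\in A$.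
   Context: A soft set over $X$ with parameter set $A$ is a map $F:A\to\mathcal P(X)$ with sections $F(t)$. $\mathrm{SE}(F)=\prod_{t\in A}F(t)$ is the set of soft elements $a:A\to X$ with $a(t)\in F(t)$ for all $t$. A soft subset of $F$ is a map $H:A\to\mathcal P(X)$ with $H(t)\subseteq F(t)$ for all $t$; $a\in_s H$ means $a(t)\in H(t)$ for all $t\in A$; $\mathrm{SE}(H)=\prod_t H(t)$ (empty if some section is empty). Soft unions and intersections are parameterwise. A soft topology $\tau$ on $F$ is a family of soft subsets of $F$ containing $F$ and the empty soft set $\Phi$ ($\Phi(t)=\varnothing$ for all $t$), closed under arbitrary soft unions and finite soft intersections. Component topology: $\tau_t=\{H(t):H\in\tau\}$ on $F(t)$. $\tau$ is canonical if $\tau=\{H\text{ soft subset of }F: H(t)\in\tau_t\ \forall t\in A\}$. Soft axioms for $(F,\tau_1,\tau_2)$, required for all distinct $a,b\in\mathrm{SE}(F)$: pairwise soft $T_0$: there is $H\in\tau_1\cup\tau_2$ such that $a\in_s H$ and $b\notin_s H$, or vice versa; pairwise soft $T_1$: there are $H\in\tau_1$, $K\in\tau_2$ with $a\in_s H$, $b\notin_s H$, $b\in_s K$, $a\notin_s K$; pairwise soft $T_2$ (pairwise selector-Hausdorff): there are $H\in\tau_1$, $K\in\tau_2$ with $a\in_s H$, $b\in_s K$, $\mathrm{SE}(H)\cap\mathrm{SE}(K)=\varnothing$. Classical axioms for a bitopological space $(Y,\alpha,\beta)$, required for all distinct $x,y\in Y$: pairwise $T_0$: some $U\in\alpha\cup\beta$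 contains exactly one of $x,y$; pairwise $T_1$: there are $U\in\alpha$, $V\in\beta$ with $x\in U$, $y\notin U$, $y\in V$, $x\notin V$; pairwise $T_2$: there are $U\in\alpha$, $V\in\beta$ with $x\in U$, $y\in V$, $U\cap V=\varnothing$. *)

(* Defs.v *)
From mathcomp Require Import all_boot.
From mathcomp Require Import boolp classical_sets.

Set Implicit Arguments.
Unset Strict Implicit.
Unset Printing Implicit Defensive.

Local Open Scope classical_set_scope.

Inductive sep_index := T0 | T1 | T2.

Section Classical.
Variable X : Type.
Implicit Types (Y : set X) (alpha beta : set (set X)).

(* The underlying set of a space is a subset Y of X (to be used with Y = F t),
   and a topology on Y is a family of subsets of X contained in Y. *)
Record is_topology Y alpha : Prop := IsTopology {
  topology_sub : forall U, alpha U -> U `<=` Y ;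
  topology_full : alpha Y ;
  topology_empty : alpha set0 ;
  topology_bigcup : forall G : set (set X),
    G `<=` alpha -> alpha (\bigcup_(U in G) U) ;
  topology_setI : forall U V, alpha U -> alpha V -> alpha (U `&` V) }.

Definition pairwise_T0 Y alpha beta : Prop :=
  forall x y, Y x -> Y y -> x <> y ->
  exists U, (alpha `|` beta) U /\ ((U x /\ ~ U y) \/ (U y /\ ~ U x)).

Definition pairwise_T1 Y alpha beta : Prop :=
  forall x y, Y x -> Y y -> x <> y ->
  exists U V, [/\ alpha U, beta V, U x /\ ~ U y & V y /\ ~ V x].

Definition pairwise_T2 Y alpha beta : Prop :=
  forall x y, Y x -> Y y -> x <> y ->
  exists U V, [/\ alpha U, beta V, U x /\ V y & U `&` V = set0].

Definition pairwise_T (j : sep_index) Y alpha beta : Prop :=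
  match j with
  | T0 => pairwise_T0 Y alpha beta
  | T1 => pairwise_T1 Y alpha beta
  | T2 => pairwise_T2 Y alpha beta
  end.

End Classical.

Definition soft_set (A X : Type) := A -> set X.

Section Soft.
Variables A X : Type.
Implicit Types (F H K : soft_set A X) (tau : set (soft_set A X)).
Implicit Types (a b : A -> X).

Definition soft_mem a H : Prop := forall t, H t (a t).

Definition SE H : set (A -> X) := [set a | soft_mem a H].

Definition soft_subset H F : Prop := forall t, H t `<=` F t.

Definition soft_empty : soft_set A X := fun=> set0.

Definition soft_bigcup (G : set (soft_set A X)) : soft_set A X :=
  fun t => \bigcup_(H in G) H t.

Definition soft_setI H K : soft_set A X := fun t => H t `&` K t.

Record is_soft_topology F tau : Prop := IsSoftTopology {
  soft_topology_sub : forall H, tau H -> soft_subset H F ;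
  soft_topology_full : tau F ;
  soft_topology_empty : tau soft_empty ;
  soft_topology_bigcup : forall G : set (soft_set A X),
    G `<=` tau -> tau (soft_bigcup G) ;
  soft_topology_setI : forall H K, tau H -> tau K -> tau (soft_setI H K) }.

Definition component tau (t : A) : set (set X) := [set H t | H in tau].

Definition soft_canonical F tau : Prop :=
  tau = [set H | soft_subset H F /\ forall t, component tau t (H t)].

Definition pairwise_soft_T0 F tau1 tau2 : Prop :=
  forall a b, SE F a -> SE F b -> a <> b ->
  exists H, (tau1 `|` tau2) H /\
    ((soft_mem a H /\ ~ soft_mem b H) \/ (soft_mem b H /\ ~ soft_mem a H)).

Definition pairwise_soft_T1 F tau1 tau2 : Prop :=
  forall a b, SE F a -> SE F b -> a <> b ->
  exists H K, [/\ tau1 H, tau2 K, soft_mem a H /\ ~ soft_mem b H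
                & soft_mem b K /\ ~ soft_mem a K].

Definition pairwise_soft_T2 F tau1 tau2 : Prop :=
  forall a b, SE F a -> SE F b -> a <> b ->
  exists H K, [/\ tau1 H, tau2 K, soft_mem a H /\ soft_mem b K
                & SE H `&` SE K = set0].

Definition pairwise_soft_T (j : sep_index) F tau1 tau2 : Prop :=
  match j with
  | T0 => pairwise_soft_T0 F tau1 tau2
  | T1 => pairwise_soft_T1 F tau1 tau2
  | T2 => pairwise_soft_T2 F tau1 tau2
  end.

Lemma component_is_topology F tau (t : A) :
  is_soft_topology F tau -> is_topology (F t) (component tau t).
Proof.
case=> sub full empty cup cap; split.
- by move=> _ [H tH <-]; exact: sub.
- by exists F.
- by exists soft_empty.
- move=> G Gt; exists (soft_bigcup [set H | tau H /\ G (H t)]).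
    by apply: cup => H [].
  apply/seteqP; split=> x.
    by case=> H [_ GH] Hx; exists (H t).
  by case=> U GU Ux; have [H tH HU] := Gt _ GU; exists H; rewrite /= HU.
- by move=> _ _ [H tH <-] [K tK <-]; exists (soft_setI H K); first exact: cap.
Qed.

End Soft.

(* Main.v *)
Require Import Defs.
From mathcomp Require Import all_boot.
From mathcomp Require Import boolp classical_sets.

Local Open Scope classical_set_scope.

(** For (i), extend two distinct points of [F t] by a common selector to two
    soft elements which differ at [t] only: whether a soft set separates them is
    then decided by its section at [t].  For (ii), two distinct soft elements
    differ at some [t], and canonicity makes the cylinder over an open subset of
    [F t] soft open. *)

Section UpdateCylinder.
Context {A X : Type}.
Implicit Types (F H : soft_set A X) (tau : set (soft_set A X)).
Implicit Types (a c : A -> X) (t : A) (U V : set X).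

(** Equality on [A] is not assumed decidable, hence the classical test [pselect]. *)
Definition update c t (x : X) : A -> X :=
  fun s => if pselect (s = t) then x else c s.

Lemma update_eq c t x : update c t x t = x.
Proof. by rewrite /update; case: pselect. Qed.

Lemma update_neq c t x s : s <> t -> update c t x s = c s.
Proof. by rewrite /update; case: pselect. Qed.

Lemma soft_mem_updateP c t x H :
  soft_mem (update c t x) H <-> H t x /\ forall s, s <> t -> H s (c s).
Proof.
split=> [Hx|[Hx Hc] s].
  split=> [|s st]; first by rewrite -(update_eq c t x); exact: Hx.
  by rewrite -(update_neq c t x s st); exact: Hx.
have [->|st] := pselect (s = t); first by rewrite update_eq.
by rewrite update_neq //; exact: Hc.
Qed.

Lemma update_inj c t x y : update c t x = update c t y -> x = y.
Proof. by move=> /(congr1 (@^~ t)); rewrite !update_eq. Qed.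

(** The guard [s = t] leaves every section of [F] unchanged except the one at [t], which is cut down
    to [U]. *)
Definition cylinder F t U : soft_set A X :=
  fun s => [set x | F s x /\ (s = t -> U x)].

(** An equality of propositions, so that it rewrites under the negations and connectives of the
    separation axioms. *)
Lemma soft_mem_cylinderE F t U a :
  SE F a -> soft_mem a (cylinder F t U) = U (a t).
Proof.
move=> Fa; apply/propext; split=> [/(_ t)[_]|Ua s]; first exact.
by split=> [|->]; first exact: Fa.
Qed.

(** By canonicity it is enough that each section is open: at [t] it is [U], as [U] lies in [F t];
    elsewhere it is the whole of [F s]. *)
Lemma cylinder_open F tau t U : is_soft_topology F tau ->
  soft_canonical F tau -> component tau t U -> tau (cylinder F t U).
Proof.
move=> top can Ut; rewrite can; split=> [s x []//|s].
have [->|st] := pselect (s = t).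
  suff -> : cylinder F t U t = U by [].
  apply/seteqP; split=> x; first by case=> _; exact.
  by move=> Ux; split=> //; exact: (topology_sub (component_is_topology t top) Ut).
suff -> : cylinder F t U s = F s by exists F => //; exact: soft_topology_full top.
by apply/seteqP; split=> x => [[]//|Fx]; split.
Qed.

Lemma SE_cylinderI F t U V : U `&` V = set0 ->
  SE (cylinder F t U) `&` SE (cylinder F t V) = set0.
Proof.
move=> UV0; rewrite -subset0 => a [/(_ t)[_ Ua] /(_ t)[_ Va]].
suff : (U `&` V) (a t) by rewrite UV0.
by split; [exact: Ua|exact: Va].
Qed.

End UpdateCylinder.

Lemma pairwise_soft_T_component (A X : Type) (F : soft_set A X)
    (tau1 tau2 : set (soft_set A X)) (j : sep_index) (t : A) :
  (forall s, F s !=set0) -> pairwise_soft_T j F tau1 tau2 ->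
  pairwise_T j (F t) (component tau1 t) (component tau2 t).
Proof.
move=> /choice[c Fc].
have SEu x : F t x -> SE F (update c t x).
  by move=> Fx; apply/soft_mem_updateP; split.
have uP x H := soft_mem_updateP c t x H.
(* Both soft elements agree with [c] off [t], where the first already lies in [H]; so the second can
   only fail at [t]. *)
have sepP x y H : soft_mem (update c t x) H ->
    ~ soft_mem (update c t y) H -> H t x /\ ~ H t y.
  by move=> /uP[Hx Hc] nHy; split=> // Hy; apply/nHy/uP.
case: j => /= sep x y Fx Fy xy;
  have /(sep _ _ (SEu _ Fx) (SEu _ Fy)) : update c t x <> update c t y
    by move=> e; apply: xy; exact: update_inj e.
- case=> H [tauH sH]; exists (H t); split.
    by case: tauH => tauH; [left|right]; exists H.
  by case: sH => -[Ha Hb]; [left|right]; exact: sepP.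
- case=> H [K [tH tK [Ha nHb] [Kb nKa]]]; exists (H t), (K t).
  by split; [exists H|exists K|exact: sepP|exact: sepP].
- case=> H [K [tH tK [/uP[Hx Hc] /uP[Ky Kc]] HK0]]; exists (H t), (K t).
  split; [by exists H|by exists K|by []|].
  (* Off [t], both [H] and [K] contain the values of [c], so a common point [z] of their sections at
     [t] would give the common soft element [update c t z]. *)
  rewrite -subset0 => z [Hz Kz].
  suff : (SE H `&` SE K) (update c t z) by rewrite HK0.
  by split; apply/uP.
Qed.

Lemma component_pairwise_soft_T (A X : Type) (F : soft_set A X)
    (tau1 tau2 : set (soft_set A X)) (j : sep_index) :
  is_soft_topology F tau1 -> is_soft_topology F tau2 ->
  soft_canonical F tau1 -> soft_canonical F tau2 ->
  (forall t, pairwise_T j (F t) (component tau1 t) (component tau2 t)) ->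
  pairwise_soft_T j F tau1 tau2.
Proof.
move=> top1 top2 can1 can2.
have open1 t U := cylinder_open F tau1 t U top1 can1.
have open2 t U := cylinder_open F tau2 t U top2 can2.
have cE t U a (Fa : SE F a) := soft_mem_cylinderE F t U a Fa.
(* In all three cases, the classical axiom is applied to [a t] and [b t] at a parameter [t] where
   they differ. *)
case: j => /= sep a b Fa Fb ab;
  have /existsNP[t /(sep t _ _ (Fa t) (Fb t))] : ~ forall t, a t = b t
    by move=> /funext.
- case=> U [tauU sU]; exists (cylinder F t U); split.
    by case: tauU => ?; [left; exact: open1|right; exact: open2].
  (* Membership of [a] and [b] in the cylinder becomes membership of [a t] and [b t] in [U], which
     is [sU]. *)
  by rewrite !cE.
- case=> U [V [tU tV sU sV]].
  exists (cylinder F t U), (cylinder F t V).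
  by rewrite !cE //; split=> //; [exact: open1|exact: open2].
- case=> U [V [tU tV UV UV0]].
  exists (cylinder F t U), (cylinder F t V).
  by rewrite !cE //; split=> //; [exact: open1|exact: open2|exact: SE_cylinderI].
Qed.

Theorem theorem5p3 (A X : Type) (hA : inhabited A) (hX : inhabited X)
    (F : soft_set A X) (hF : forall t : A, F t !=set0)
    (tau1 tau2 : set (soft_set A X))
    (htau1 : is_soft_topology F tau1) (htau2 : is_soft_topology F tau2)
    (j : sep_index) :
  [/\ (pairwise_soft_T j F tau1 tau2 ->
        forall t : A, pairwise_T j (F t) (component tau1 t) (component tau2 t)),
      (soft_canonical F tau1 -> soft_canonical F tau2 ->
        (forall t : A,
           pairwise_T j (F t) (component tau1 t) (component tau2 t)) ->
        pairwise_soft_T j F tau1 tau2)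
    & (soft_canonical F tau1 -> soft_canonical F tau2 ->
        (pairwise_soft_T j F tau1 tau2 <->
         forall t : A,
           pairwise_T j (F t) (component tau1 t) (component tau2 t)))].
Proof.
have soft_comp : pairwise_soft_T j F tau1 tau2 -> forall t,
    pairwise_T j (F t) (component tau1 t) (component tau2 t).
  by move=> sep t; exact: pairwise_soft_T_component.
split=> // [can1 can2|can1 can2]; first exact: component_pairwise_soft_T.
by split=> //; exact: component_pairwise_soft_T.
Qed.
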